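(* Let $d\ge 0$ be an integer, and let $L$ be a knot whose Jones polynomial $J_L(t)=\sum_k a_k(L)\,t^k$ has degree at most $d$. Then for every integer $n$ with $-d\le n\le d$, $$a_n(L)=\sum_{i=0}^{2d} f_{d,n}^{(i)}(0)\,v_i(L),\qquad\text{where } f_{d,n}(v)=\prod_{\substack{j=-d\\ j\ne n}}^{d}\frac{v-j}{n-j}$$ and $f_{d,n}^{(i)}$ denotes the $i$-th derivative of the polynomial $f_{d,n}$ with respect to $v$.
   Context: The Jones polynomial $J_L(t)$ of an oriented knot in $S^3$ is normalized by $J_{\mathrm{unknot}}=1$ and $t^{-1}J_{L_+}-tJ_{L_-}=(t^{1/2}-t^{-1/2})J_{L_0}$; for a knot it lies in $\mathbb{Z}[t,t^{-1}]$. If $J_L(t)=a_{-m}t^{-m}+\cdots+a_nt^n$ with $a_{-m},a_n$ nonzero, its degree is $\max(m,n)$; thus degree at most $d$ means $a_k(L)=0$ for $|k|>d$. The invariants $v_i$ are defined by the expansion $J_L(e^x)=\sum_{i=0}^\infty v_i(L)x^i$, i.e. $v_i(L)=\frac{1}{i!}\sum_{k}k^i a_k(L)$ (with $0^0=1$); $v_i$ is known to be a Vassiliev invariant of order $i$. *)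

(* Defs.v *)
From mathcomp Require Import all_boot all_order all_algebra all_fingroup.
From mathcomp Require Import finmap.
From mathcomp Require Import all_classical all_reals all_analysis.

Set Implicit Arguments.
Unset Strict Implicit.
Unset Printing Implicit Defensive.

Import Order.TTheory GRing.Theory Num.Theory.
Import numFieldNormedType.Exports.

Local Open Scope classical_set_scope.
Local Open Scope ring_scope.

(** * Oriented polygonal links in 3-space

Knots and links are taken in the classical polygonal category (Reidemeister):
tame oriented links in the 3-sphere up to ambient isotopy are the same as
oriented closed polygons in 3-space up to triangle moves. *)

(* A system of closed oriented polygons: each vertex [i] is joined to
   [next i] by a straight edge directed from [i] to [next i], so that the
   components are the cycles of the permutation [next]. *)
Record polygon (R : realType) := Polygon {
  vertex : finType;
  next : {perm vertex};
  pos : vertex -> 'rV[R]_3 }.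

Section Polygons.
Variable R : realType.
Implicit Types (P : polygon R) (s t : R).

Definition edge P (i : vertex P) s : 'rV[R]_3 :=
  (1 - s) *: pos i + s *: pos (next P i).

Definition trace P : set 'rV[R]_3 :=
  [set x | exists i : vertex P, exists2 s, 0 <= s <= 1 & x = edge i s].

(* The half-open edges cover the polygons, each point being reached once: the
   components are simple and pairwise disjoint. *)
Definition embedded P : Prop :=
  forall (i j : vertex P) s t, 0 <= s < 1 -> 0 <= t < 1 ->
    edge i s = edge j t -> i = j /\ s = t.

Definition hull (a : seq 'rV[R]_3) : set 'rV[R]_3 :=
  [set x | exists w : 'I_(size a) -> R,
     [/\ forall k, 0 <= w k, \sum_k w k = 1 & x = \sum_k w k *: a`_k]].

Definition insert_fun P (i : vertex P) (u : option (vertex P)) :=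
  if u is Some x then (if x == i then None else Some (next P x))
  else Some (next P i).

Lemma insert_fun_inj P (i : vertex P) : injective (insert_fun i).
Proof.
move=> [x|] [y|] //=.
- case: eqVneq => [->|xi]; case: eqVneq => [->|yi] //.
  by move=> [] /perm_inj ->.
- by case: eqVneq => // /eqP xi [] /perm_inj.
- by case: eqVneq => // /eqP yi [] /perm_inj/esym.
Qed.

(* Replaces the edge from [i] to [next i] by two edges through the new vertex
   [None], placed at [c]. *)
Definition insert P (i : vertex P) (c : 'rV[R]_3) : polygon R :=
  {| vertex := option (vertex P);
     next := perm (@insert_fun_inj P i);
     pos := oapp (@pos R P) c |}.

(* Replaces the edges [i -> next i] and [j -> next j] by [i -> next j] and
   [j -> next i]. *)
Definition splice P (i j : vertex P) : polygon R :=
  {| vertex := vertex P; next := (tperm i j * next P)%g; pos := @pos R P |}.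

End Polygons.

Record link (R : realType) := Link {
  link_polygon :> polygon R;
  link_embedded : embedded link_polygon }.

Section Links.
Variable R : realType.
Implicit Types K L : link R.

Definition is_knot L : Prop := #|porbits (next L)| = 1%N.

Definition relabelling L L' : Prop :=
  exists f : vertex L -> vertex L', [/\ bijective f,
    forall i, next L' (f i) = f (next L i) & forall i, pos (f i) = pos i].

Definition triangle_move L L' : Prop :=
  exists (i : vertex L) (c : 'rV[R]_3),
    link_polygon L' = insert i c /\
    hull [:: pos i; c; pos (next L i)] `&` trace L
      `<=` hull [:: pos i; pos (next L i)].

Inductive isotopic : link R -> link R -> Prop :=
| isotopic_refl L : isotopic L L
| isotopic_sym L L' : isotopic L L' -> isotopic L' L
| isotopic_trans L L' L'' : isotopic L L' -> isotopic L' L'' -> isotopic L L''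
| isotopic_relabelling L L' : relabelling L L' -> isotopic L L'
| isotopic_triangle L L' : triangle_move L L' -> isotopic L L'.

(* An embedded polygon with three vertices is a triangle. *)
Definition is_unknot L : Prop :=
  exists2 T : link R, #|vertex T| = 3%N & isotopic T L.

Definition det3 (u v w : 'rV[R]_3) : R :=
  \det (\matrix_(k < 3) [:: u; v; w]`_k).

(* A local crossing change and its oriented smoothing.  Write a0 -> a1 and
   b0 -> b1 for the edges of L+ starting at [i] and [j].  The broken line
   a0 -> c -> a1 replaces a0 -> a1 in L-; since b0 b1 crosses the interior of
   the triangle a0 a1 c, say at q, the two pass on opposite sides of b0 b1.
   Projecting along the line q c, which maps both onto the same segment, shows
   three diagrams that differ only inside the image of the convex ball
   conv(a0, a1, c, b0, b1): a crossing of a0 a1 with b0 b1, the opposite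
   crossing, and the arcs a0 -> b1 and b0 -> a1.  A crossing of directions u
   and v at points p and q of the same projection has the sign of
   det(u, v, p - q), whichever strand is over; here this is the sign of
   det(a1 - a0, b1 - b0, a0 - b0), and it is positive for L+. *)
Definition skein_triple (Lp Lm L0 : link R) : Prop :=
  exists (i j : vertex Lp) (c : 'rV[R]_3),
    let a0 := pos i in let a1 := pos (next Lp i) in
    let b0 := pos j in let b1 := pos (next Lp j) in
    [/\ 0 < det3 (a1 - a0) (b1 - b0) (a0 - b0),
        (exists r0 r1 rc s : R, [/\ [/\ 0 < r0, 0 < r1 & 0 < rc],
          r0 + r1 + rc = 1, 0 < s < 1
          & r0 *: a0 + r1 *: a1 + rc *: c = edge j s]),
        hull [:: a0; a1; c; b0; b1] `&` trace Lp
          `<=` hull [:: a0; a1] `|` hull [:: b0; b1],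
        link_polygon Lm = insert i c &
        link_polygon L0 = splice i j].

End Links.

(** * The Jones polynomial *)

(* Integer Laurent polynomials in t^(1/2): [p k] is the coefficient of
   t^(k/2). *)
Definition laurent_half := {fsfun int -> int with 0}.

(* Multiplication by t^(m/2). *)
Definition shift (m : int) (p : laurent_half) (k : int) : int := p (k - m).

(* The last clause is a classical consequence of the others. *)
Record is_jones (R : realType) (J : link R -> laurent_half) : Prop := {
  jones_isotopic : forall L L', isotopic L L' -> J L = J L';
  jones_unknot : forall L, is_unknot L ->
    forall k, J L k = (k == 0)%:R;
  jones_skein : forall Lp Lm L0, skein_triple Lp Lm L0 ->
    forall k, shift (-2) (J Lp) k - shift 2 (J Lm) k
            = shift 1 (J L0) k - shift (-1) (J L0) k;
  jones_knot : forall L, is_knot L ->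
    forall k, ~~ (2 %| k)%Z -> J L k = 0 }.

Section Invariants.
Variables (R : realType) (J : link R -> laurent_half).
Implicit Types L : link R.

(* The coefficient a_n(L) of t^n. *)
Definition jones_coef L (n : int) : int := J L (2 * n).

Definition jones_degree_le L (d : nat) : Prop :=
  forall k : int, d%:Z < `|k| -> jones_coef L k = 0.

Definition jones_at L (t : R) : R :=
  \sum_(k <- finsupp (J L)) (J L k)%:~R * t `^ (k%:~R / 2).

Definition jones_expansion L (v : nat -> R) : Prop :=
  forall x : R, series (fun i => v i * x ^+ i) @ \oo --> jones_at L (expR x).

(* The sequence of coefficients v_i(L) of the expansion of J_L(e^x). *)
Definition vassiliev L : nat -> R :=
  get [set v : nat -> R | jones_expansion L v].

End Invariants.

Definition node_poly (R : realType) (d : nat) (n : int) : {poly R} :=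
  \prod_(k < (2 * d).+1 | k%:Z - d%:Z != n)
     ((n - (k%:Z - d%:Z))%:~R^-1 *: ('X - (k%:Z - d%:Z)%:~R%:P)).

(* Main.v *)
(** The series of J_L(e^x) = sum_k a_k e^(k x) converges everywhere and its
coefficients v_i = sum_k a_k k^i / i! are unique, so the right-hand side equals
sum_k a_k sum_i (f^(i)(0) / i!) k^i.  As deg f <= 2 d, the inner sum is f(k) by
Taylor's formula at 0, and f(k) = delta_{k,n} at the nodes -d, ..., d. *)

Require Import Defs.
From mathcomp Require Import all_boot all_order all_algebra.
From mathcomp Require Import finmap.
From mathcomp Require Import all_classical all_reals all_analysis.
From mathcomp Require Import zify ring lra.
Import Order.TTheory GRing.Theory Num.Theory.
Import numFieldNormedType.Exports.

Local Open Scope ring_scope.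

Lemma series_shift_head (R : realType) (c : nat -> R) (x : R) (n : nat) :
  series (fun i => c i * x ^+ i) n.+1 =
    c 0 + x * series (fun i => c i.+1 * x ^+ i) n.
Proof.
rewrite /series /= big_nat_recl //= expr0 mulr1 mulr_sumr; congr (_ + _).
by apply: eq_bigr => i _; rewrite exprS mulrCA.
Qed.

(** If the coefficients are bounded by [M], the terms after [c 0] contribute at most [x * (2 * M)]
    in absolute value for [0 < x <= 1 / 2]; a small [x] then leaves no room for a nonzero [c 0]. *)
Lemma pseries_eq0_head (R : realType) (c : nat -> R) :
  (forall x : R, x != 0 ->
    (series (fun i => c i * x ^+ i) @ \oo --> (0 : R))%classic) ->
  c 0 = 0.
Proof.
move=> c_cvg.
(* Convergence at x = 1 makes the coefficients themselves bounded. *)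
have [M M_gt0 cM] : exists2 M : R, 0 < M & forall i, `|c i| <= M.
  have /cvg_series_bounded [K [_ cK]] :
      cvgn (series (fun i => c i * 1 ^+ i)).
    by apply/cvg_ex; exists 0; apply: c_cvg; rewrite oner_eq0.
  exists (`|K| + 1); first by rewrite ltr_wpDl.
  move=> i; have := cK (`|K| + 1) _ i I.
  by rewrite /= expr1n mulr1; apply; rewrite ltr_pwDr // ler_norm.
have c0_le x : 0 < x -> x <= 1 / 2 -> `|c 0| <= x * (2 * M).
  move=> x_gt0 x_le.
  have S_cvg : ((fun n => `|c 0 - series (fun i => c i * x ^+ i) n.+1|) @ \oo
      --> `|c 0 - 0|)%classic.
    apply: cvg_norm; apply: cvgB; first exact: cvg_cst.
    rewrite (cvg_shiftS (series (fun i => c i * x ^+ i))).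
    by apply: c_cvg; rewrite gt_eqF.
  rewrite -[c 0]subr0; apply: (cvgr_to_le S_cvg); apply: nearW => n.
  rewrite series_shift_head opprD addNKr normrN normrM (gtr0_norm x_gt0).
  rewrite ler_pM2l //.
  apply: (le_trans (ler_norm_sum _ _ _)).
  apply: (@le_trans _ _ (\sum_(0 <= i < n) M * x ^+ i)).
    apply: ler_sum => i _; rewrite normrM normrX (gtr0_norm x_gt0).
    by rewrite ler_wpM2r // exprn_ge0 // ltW.
  rewrite -mulr_sumr mulrC ler_pM2r // big_mkord.
  (* The geometric sum satisfies [(1 - x) * S = 1 - x ^+ n <= 1], and [x <= 1 / 2] then gives
     [S <= 2]. *)
  have := subrX1 x n; set S := \sum_(_ < _) _ => xS.
  have S_ge0 : 0 <= S by apply: sumr_ge0 => i _; rewrite exprn_ge0 // ltW.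
  have := exprn_ge0 n (ltW x_gt0).
  nra.
apply/eqP/negPn/negP => c0_neq0.
have c0_gt0 : 0 < `|c 0| by rewrite normr_gt0.
(* For this [x] the bound [x * (2 * M)] is at most half of [|c 0|], a contradiction. *)
have x_gt0 : 0 < Num.min (1 / 2) (`|c 0| / (4 * M)).
  by rewrite lt_min !divr_gt0 // mulr_gt0.
have := c0_le _ x_gt0; rewrite ge_min lexx => /(_ isT).
apply/negP; rewrite -ltNge.
apply: (@le_lt_trans _ _ (`|c 0| / (4 * M) * (2 * M))).
  by rewrite ler_pM2r ?mulr_gt0 // ge_min lexx orbT.
have -> : `|c 0| / (4 * M) * (2 * M) = `|c 0| / 2 by field; rewrite gt_eqF.
by rewrite ltr_pdivrMr // mulr_natr mulr2n ltrDl.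
Qed.

(* Excluding x = 0 lets the hypothesis pass to the shifted coefficients
   [c i.+1] on division by x, with no continuity argument at 0. *)
Lemma pseries_eq0 (R : realType) (m : nat) (c : nat -> R) :
  (forall x : R, x != 0 ->
    (series (fun i => c i * x ^+ i) @ \oo --> (0 : R))%classic) ->
  c m = 0.
Proof.
elim: m c => [|m IHm] c c_cvg; first exact: pseries_eq0_head.
apply: (IHm (fun i => c i.+1)) => x x_neq0.
have -> : series (fun i => c i.+1 * x ^+ i) =
    (fun n => x^-1 * (series (fun i => c i * x ^+ i) n.+1 - c 0)).
  by apply/funext => n; rewrite series_shift_head addrAC subrr add0r mulKf.
(* As [c 0] vanishes, the limit 0 can be written [x^-1 * (0 - c 0)]. *)
rewrite -[X in (_ --> X)%classic](mulr0 x^-1).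
apply: cvgM; first exact: cvg_cst.
rewrite -[X in (_ --> X)%classic](subr0 0) -{2}(pseries_eq0_head _ _ c_cvg).
apply: cvgB; last exact: cvg_cst.
by rewrite (cvg_shiftS (series (fun i => c i * x ^+ i))); exact: c_cvg.
Qed.

Lemma jones_expansion_unique (R : realType) (J : link R -> laurent_half)
    (L : link R) (v w : nat -> R) :
  jones_expansion J L v -> jones_expansion J L w -> v = w.
Proof.
move=> v_exp w_exp; apply/funext => m; apply/eqP; rewrite -subr_eq0; apply/eqP.
apply: (pseries_eq0 _ m (fun i => v i - w i)) => x _.
have -> : series (fun i => (v i - w i) * x ^+ i) =
    (fun n => series (fun i => v i * x ^+ i) n
              - series (fun i => w i * x ^+ i) n).
  apply/funext => n; rewrite /series /= -sumrB.
  by apply: eq_bigr => i _; rewrite mulrBl.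
by rewrite -(subrr (jones_at J L (expR x))); apply: cvgB.
Qed.

(* The index [k] counts powers of t^(1/2), so that the exponent of t is [k / 2]. *)
Definition power_sums {R : realType} (J : link R -> laurent_half) (L : link R)
    (i : nat) : R :=
  \sum_(k <- finsupp (J L)) (J L k)%:~R * (k%:~R / 2) ^+ i / i`!%:R.

(** Each monomial t^(k/2) becomes e^(x k/2), whose exponential series converges everywhere; the sum
    over the finite support commutes with the limit. *)
Lemma jones_expansion_power_sums (R : realType) (J : link R -> laurent_half)
    (L : link R) : jones_expansion J L (power_sums J L).
Proof.
move=> x; rewrite /jones_at.
have -> : series (fun i => power_sums J L i * x ^+ i) =
    \sum_(k <- finsupp (J L))
      (fun n => (J L k)%:~R * series (exp_coeff (x * (k%:~R / 2))) n).
  apply/funext => n; rewrite fct_sumE /series /=.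
  under [RHS]eq_bigr do rewrite mulr_sumr.
  rewrite [RHS]exchange_big /=; apply: eq_bigr => i _.
  rewrite mulr_suml; apply: eq_bigr => k _.
  by rewrite /exp_coeff /= [(x * _) ^+ i]exprMn; ring.
elim/big_ind2: _ => [|u l v m u_cvg v_cvg|k _].
- exact: cvg_cst.
- exact: cvgD.
- apply: cvgM; first exact: cvg_cst.
  rewrite -expRM; exact: is_cvg_series_exp_coeff.
Qed.

(** [vassiliev] is picked by [get], so its value is determined only because an expansion exists and
    is unique. *)
Lemma vassilievE (R : realType) (J : link R -> laurent_half) (L : link R) :
  vassiliev J L = power_sums J L.
Proof.
apply: get_unique; first exact: jones_expansion_power_sums.
move=> v v_exp; apply: jones_expansion_unique v_exp _.
exact: jones_expansion_power_sums.
Qed.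

Lemma horner0_derivn (R : nzSemiRingType) (i : nat) (p : {poly R}) :
  (p^`(i)).[0] = p`_i *+ i`!.
Proof. by rewrite horner_coef0 coef_derivn addn0 ffactnn. Qed.

Section NodePoly.
Variables (R : realType) (d : nat) (n : int).
Hypotheses (n_ge : - d%:Z <= n) (n_le : n <= d%:Z).

Lemma node_index (m : int) : - d%:Z <= m -> m <= d%:Z ->
  exists k : 'I_(2 * d).+1, k%:Z - d%:Z = m.
Proof.
move=> m_ge m_le.
have k_lt : (`|(m + d%:Z)%R| < (2 * d).+1)%N by lia.
by exists (Ordinal k_lt) => /=; lia.
Qed.

(** Since [n] is itself a node, its index [k0] is left out and at most 2d linear factors remain. *)
Lemma size_node_poly : (size (node_poly R d n) <= (2 * d).+1)%N.
Proof.
have [k0 k0E] := node_index n n_ge n_le.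
rewrite /node_poly; set P := (X in \prod_(k < _ | X k) _).
apply: (leq_trans (size_poly_prod_leq _ _)).
have P_lt : (#|P| < (2 * d).+1)%N.
  rewrite -[X in (_ < X)%N]card_ord; apply: proper_card; apply/properP.
  split; first exact/fintype.subsetP.
  by exists k0; rewrite // unfold_in k0E eqxx.
(* The product has size at most one plus the sum of the sizes, minus [#|P|]; with sizes at most 2
   this is at most [#|P| + 1]. *)
rewrite leq_subLR.
apply: (@leq_trans (\sum_(k < (2 * d).+1 | P k) 2).+1).
  rewrite ltnS; apply: leq_sum => k _.
  by apply: (leq_trans (size_scale_leq _ _)); rewrite size_XsubC.
by rewrite sum_nat_const -/P; move: #|P| P_lt => p; lia.
Qed.

(** At [n] every factor equals 1; at any other node [m], the factor indexed by [m] vanishes. *)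
Lemma horner_node_poly (m : int) : - d%:Z <= m -> m <= d%:Z ->
  (node_poly R d n).[m%:~R] = (m == n)%:R.
Proof.
move=> m_ge m_le; rewrite /node_poly horner_prod.
have [->|m_neq] := eqVneq m n.
  rewrite big1 // => k k_neq; rewrite hornerZ hornerXsubC -intrB mulVf //.
  by rewrite intr_eq0 subr_eq0 eq_sym.
have [k kE] := node_index m m_ge m_le.
rewrite (bigD1 k) /=; last by rewrite kE.
by rewrite hornerZ hornerXsubC kE subrr mulr0 mul0r.
Qed.

End NodePoly.

Theorem theorem3p2 (R : realType) (J : link R -> laurent_half)
    (J_jones : is_jones J) (d : nat) (L : link R) (L_knot : is_knot L)
    (L_deg : jones_degree_le J L d) (n : int) (n_ge : - d%:Z <= n)
    (n_le : n <= d%:Z) :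
  (jones_coef J L n)%:~R =
    \sum_(i < (2 * d).+1) (derivn i (node_poly R d n)).[0] * vassiliev J L i.
Proof.
rewrite vassilievE.
transitivity (\sum_(k <- finsupp (J L))
    (J L k)%:~R * (node_poly R d n).[k%:~R / 2]); last first.
  under [RHS]eq_bigr do rewrite mulr_sumr.
  rewrite [RHS]exchange_big /=; apply: eq_bigr => k _.
  rewrite (horner_coef_wide _ (size_node_poly R d n n_ge n_le)) mulr_sumr.
  apply: eq_bigr => i _; rewrite horner0_derivn -[_ *+ _]mulr_natr.
  have : i`!%:R != 0 :> R by rewrite pnatr_eq0 -lt0n fact_gt0.
  by move=> fact_neq0; field.
transitivity (\sum_(k <- finsupp (J L)) (J L k)%:~R * (k == 2 * n)%:R : R).
  rewrite /jones_coef; have [n_supp|n_supp] := boolP (2 * n \in finsupp (J L)).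
    rewrite (bigD1_seq (2 * n)) ?fset_uniq //= eqxx mulr1 big1 ?addr0 //.
    by move=> k /negPf ->; rewrite mulr0.
  (* Outside the support, [J L (2 * n)] is the default value 0, and no term of the sum survives. *)
  rewrite big1_seq; first by move: n_supp; rewrite memNfinsupp => /eqP ->.
  move=> k /= k_supp; case: eqP k_supp => [->|_ _]; last by rewrite mulr0.
  by rewrite (negPf n_supp).
apply: eq_big_seq => k; rewrite mem_finsupp => Jk_neq0; congr (_ * _).
(* For a knot only integer powers of t occur, so [k / 2] is an integer [m], which the degree bound
   places among the nodes. *)
have [m kE] : exists m, k = 2 * m.
  have /dvdzP[m ->] : (2 %| k)%Z.
    by apply: contraNT Jk_neq0 => k_odd; apply/eqP; apply: (jones_knot J_jones).
  by exists m; rewrite mulrC.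
have m_le : `|m| <= d%:Z.
  by rewrite leNgt; apply: contraNN Jk_neq0 => /L_deg; rewrite /jones_coef -kE => ->.
have -> : k%:~R / 2 = m%:~R :> R by rewrite kE intrM mulrC mulKf.
rewrite horner_node_poly //; try lia.
by rewrite kE (inj_eq (mulfI _)).
Qed.
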